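(* Let $N\ge1$ and let $\beta_1,\beta_2,\alpha_1,\dots,\alpha_N,x_1,\dots,x_N$ be real. Let $e_k=e_k(x_1,\dots,x_N)$ be the coefficients in $W(t)=\sum_{k=0}^{N+1}e_kt^k$, where $$W(t)=(\beta_1+1)(1-t)\prod_{j=1}^N(1-x_jt)-(\beta_2+1)\,t\prod_{j=1}^N(1-x_jt)-\sum_{l=1}^N(\alpha_l+1)x_l\,t(1-t)\prod_{j\ne l}(1-x_jt).$$ Then for $k=0,\dots,N+1$, $$e_k=(\beta_1+1)v_k+(\beta_2+1)w_k+\sum_{l=1}^N(\alpha_l+1)x_lz_{k,l},$$ where $$v_k=(-1)^k[\sigma_k(x_1,\dots,x_N)+\sigma_{k-1}(x_1,\dots,x_N)],\qquad w_k=(-1)^k\sigma_{k-1}(x_1,\dots,x_N),$$ $$z_{k,l}=(-1)^k[\sigma_{k-1}((x_i)_{i\ne l})+\sigma_{k-2}((x_i)_{i\ne l})].$$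
   Context: $\sigma_l(y_1,\dots,y_k)$ is the $l$-th elementary symmetric polynomial in $k$ variables, with $\sigma_0=1$ (also for $k=0$) and $\sigma_l=0$ if $l<0$ or $l>k$. *)

(* Defs.v *)
From HB Require Import structures.
From mathcomp Require Import all_boot all_order all_algebra.
From mathcomp Require Import reals.
From mathcomp Require Import mpoly.

Set Implicit Arguments.
Unset Strict Implicit.
Unset Printing Implicit Defensive.

Import GRing.Theory.
Local Open Scope ring_scope.

Section Defs.
Variable R : realType.

(* The index l is an integer, because sigma_(k-1) and sigma_(k-2) are used with
   k = 0 and k = 1; [mesym n R m] is already 0 for m > n. *)
Definition sigma (n : nat) (l : int) (y : 'I_n -> R) : R :=
  match l with
  | Posz m => (mesym n R m).@[y]
  | Negz _ => 0
  end.

Definition omit (N : nat) (l : 'I_N) (x : 'I_N -> R) : 'I_N.-1 -> R :=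
  fun j => x (lift l j).

Variables (N : nat) (beta1 beta2 : R) (alpha x : 'I_N -> R).

Definition W : {poly R} :=
  (beta1 + 1) *: ((1 - 'X) * \prod_(j < N) (1 - x j *: 'X))
  - (beta2 + 1) *: ('X * \prod_(j < N) (1 - x j *: 'X))
  - \sum_(l < N) ((alpha l + 1) * x l) *:
      ('X * (1 - 'X) * \prod_(j < N | j != l) (1 - x j *: 'X)).

Definition v (k : nat) : R :=
  (-1) ^+ k * (sigma k%:Z x + sigma (k%:Z - 1) x).

Definition w (k : nat) : R :=
  (-1) ^+ k * sigma (k%:Z - 1) x.

Definition z (k : nat) (l : 'I_N) : R :=
  (-1) ^+ k * (sigma (k%:Z - 1) (omit l x) + sigma (k%:Z - 2) (omit l x)).

End Defs.

(* Main.v *)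
Require Import Defs.
From HB Require Import structures.
From mathcomp Require Import all_boot all_order all_algebra.
From mathcomp Require Import zify ring.
From mathcomp Require Import reals.
From mathcomp Require Import mpoly.

(** The linear polynomials [1 - y_j t] multiply out, by choosing from each
factor either [1] or [- y_j t], to the generating polynomial
[prod_j (1 - y_j t) = sum_m (-1)^m sigma_m(y) t^m] of the elementary symmetric
polynomials.  Each of the three parts of [W] is such a product, for all the
[x_j] or for all but one of them, multiplied by [1 - t], [t] or [t (1 - t)];
multiplication by [t] shifts the index of [sigma] down by one and changes the
sign, so these factors turn [(-1)^k sigma_k] into [(-1)^k] times
[sigma_k + sigma_(k-1)], [- sigma_(k-1)] and [- (sigma_(k-1) + sigma_(k-2))].

The resulting formula holds at every [k], and its right-hand side is zero
beyond [N + 1], where every symmetric polynomial in it has index larger than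
its number of variables; hence the coefficients up to [N + 1] determine [W]. *)

Set Implicit Arguments.
Unset Strict Implicit.
Unset Printing Implicit Defensive.

Import GRing.Theory.
Local Open Scope ring_scope.

(** The subset [J] of the indices at which [- y_j t] is chosen contributes to
the power [#|J|] only, and the monomials of [mesym] are indexed by the same
subsets. *)
Lemma coef_prod_1subZX (S : comNzRingType) (n : nat) (y : 'I_n -> S) (k : nat) :
  (\prod_(j < n) (1 - y j *: 'X))`_k = (-1) ^+ k * (mesym n S k).@[y].
Proof.
have -> : \prod_(j < n) (1 - y j *: 'X) =
    \sum_(J : {set 'I_n}) (\prod_(j in J) - y j) *: 'X^#|J|.
  under eq_bigr do rewrite addrC -scaleNr.
  rewrite bigA_distr; apply: eq_bigr => J _.
  by rewrite -big_mkcond /= scaler_prod prodr_const.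
rewrite coef_sum /mesym raddf_sum mulr_sumr [RHS]big_mkcond /=.
apply: eq_bigr => J _; rewrite coefZ coefXn eq_sym.
case: eqP => [<- | _]; last by rewrite mulr0.
rewrite mulr1 prodrN rmorph_prod /=.
by congr (_ * _); apply: eq_bigr => j _; rewrite mevalXU.
Qed.

Section Coefficients.
Variables (R : realType) (n : nat) (y : 'I_n -> R).

Lemma sigma_gt (l : int) : (n%:Z < l)%R -> sigma l y = 0.
Proof. by case: l => // m lt_nm; rewrite /sigma mesym_geqnE ?meval0. Qed.

Let P := \prod_(j < n) (1 - y j *: 'X).

Lemma coef_prod_sigma (k : nat) : P`_k = (-1) ^+ k * sigma k%:Z y.
Proof. exact: coef_prod_1subZX. Qed.

Lemma coefX_prod_sigma (k : nat) :
  ('X * P)`_k = - ((-1) ^+ k * sigma (k%:Z - 1) y).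
Proof.
rewrite coefXM; case: k => [|k]; first by rewrite mulr0 oppr0.
have -> : k.+1%:Z - 1 = k%:Z by rewrite intS addrC addKr.
by rewrite coef_prod_sigma exprS mulN1r mulNr opprK.
Qed.

Lemma coefX2_prod_sigma (k : nat) :
  ('X * ('X * P))`_k = (-1) ^+ k * sigma (k%:Z - 2) y.
Proof.
rewrite coefXM; case: k => [|k]; first by rewrite mulr0.
have -> : k.+1%:Z - 2 = k%:Z - 1 by rewrite intS; ring.
by rewrite coefX_prod_sigma exprS mulN1r mulNr.
Qed.

End Coefficients.

Lemma big_neq_lift (S : Type) (idx : S) (op : Monoid.com_law idx) (n : nat)
    (l : 'I_n) (F : 'I_n -> S) :
  \big[op/idx]_(j < n | j != l) F j = \big[op/idx]_(i < n.-1) F (lift l i).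
Proof.
rewrite (reindex_omap (lift l) (unlift l)) /=.
  by apply: eq_bigl => i; rewrite liftK eqxx eq_sym neq_lift.
by move=> j; case: unliftP => [i -> | ->]; rewrite ?eqxx.
Qed.

Lemma coef_W (R : realType) (N : nat) (beta1 beta2 : R) (alpha x : 'I_N -> R)
    (k : nat) :
  (W beta1 beta2 alpha x)`_k =
    (beta1 + 1) * v x k + (beta2 + 1) * w x k
    + \sum_(l < N) (alpha l + 1) * x l * z x k l.
Proof.
rewrite /W !coefB !coefZ coef_sum mulrBl mul1r coefB.
rewrite coefX_prod_sigma coef_prod_sigma -sumrN /v /w.
congr (_ + _); first by ring.
apply: eq_bigr => l _; rewrite big_neq_lift coefZ -mulrN /z.
set Q := \prod_(i < _) _.
have -> : 'X * (1 - 'X) * Q = 'X * Q - 'X * ('X * Q) by ring.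
by rewrite coefB coefX_prod_sigma coefX2_prod_sigma /omit; ring.
Qed.

(** Read off from the coefficients: at [k >= N + 2] the lowest indices that
occur are [k - 1 > N] for all the variables and [k - 2 > N - 1] for all but
one. *)
Lemma size_W (R : realType) (N : nat) (beta1 beta2 : R)
    (alpha x : 'I_N -> R) :
  (size (W beta1 beta2 alpha x) <= N.+2)%N.
Proof.
apply/leq_sizeP => k le_Nk; rewrite coef_W /v /w.
rewrite !sigma_gt ?addr0 ?mulr0 ?add0r; try lia.
apply: big1 => l _; have lt_lN := ltn_ord l.
by rewrite /z !sigma_gt ?addr0 ?mulr0 //; lia.
Qed.

Theorem lemma4p3 (R : realType) (N : nat) (hN : (1 <= N)%N)
    (beta1 beta2 : R) (alpha x : 'I_N -> R) :
  let e (k : nat) : R := (W beta1 beta2 alpha x)`_k in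
  W beta1 beta2 alpha x = \sum_(0 <= k < N.+2) e k *: 'X^k /\
  forall k : nat, (k <= N.+1)%N ->
    e k = (beta1 + 1) * v x k + (beta2 + 1) * w x k
          + \sum_(l < N) (alpha l + 1) * x l * z x k l.
Proof.
move=> e; split=> [|k _]; last exact: coef_W.
rewrite big_mkord -poly_def; apply/polyP => k; rewrite coef_poly.
case: ltnP => // le_Nk.
by rewrite nth_default // (leq_trans (size_W _ _ _ _)).
Qed.
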